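(* Let $G$ be an amenable topological group acting continuously by linear isometries on $C(K)$, where $K$ is a compact Hausdorff space, and let $\alpha'$ be the induced continuous action of $G$ on $K$ by homeomorphisms. Suppose that either (1) $K$ can be written as a finite disjoint union of minimal subspaces of $\alpha'$, or (2) $K$ is metrizable and can be written as a disjoint union of (arbitrarily many) minimal subspaces of $\alpha'$. Then $C(K)$ admits an equivalent $G$-invariant strictly convex norm.
   Context: $C(K)$ is the real Banach space of continuous functions on $K$ with the sup norm. By the Banach–Stone theorem every surjective linear isometry $T$ of $C(K)$ has the form $T(f)(x)=\psi(x)f(\phi^{-1}(x))$ for a unique homeomorphism $\phi$ of $K$ and continuous $\psi\colon K\to\{-1,1\}$; the map $T\mapsto\phi$ is a continuous homomorphism $\mathrm{Iso}(C(K))\to\mathrm{Homeo}(K)$, and $\alpha'(g)$ is the homeomorphism associated to the isometry by which $g$ acts. A minimal subspace of $\alpha'$ is a nonempty closed $\alpha'$-invariant subset of $K$ containing no proper nonempty closed invariant subset. A topological group is amenable if every continuous action of it on a compact Hausdorff space admits an invariant regular Borel probability measure. A norm is $G$-invariant if each $g$ acts isometrically for it; strictly convex if for $f\neq h$ of equal norm, $\|\frac{f+h}{2}\|<\|f\|$. *)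

(* Defs.v *)
From HB Require Import structures.
From mathcomp Require Import all_boot all_order all_algebra.
From mathcomp Require Import all_classical all_reals all_analysis.
Set Implicit Arguments. Unset Strict Implicit. Unset Printing Implicit Defensive.
Import Order.TTheory GRing.Theory Num.Theory.
Import numFieldNormedType.Exports.
Local Open Scope classical_set_scope.
Local Open Scope ring_scope.

Definition is_topgroup (G : topologicalType) (mul : G -> G -> G) (inv : G -> G)
  (one : G) : Prop :=
  [/\ (forall a b c, mul a (mul b c) = mul (mul a b) c),
      (forall a, mul one a = a /\ mul a one = a),
      (forall a, mul (inv a) a = one /\ mul a (inv a) = one),
      continuous (fun p : G * G => mul p.1 p.2) &
      continuous inv].

Definition cont_action (G : topologicalType) (mul : G -> G -> G) (one : G)
  (X : topologicalType) (a : G -> X -> X) : Prop :=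
  [/\ (forall x, a one x = x),
      (forall g h x, a (mul g h) x = a g (a h x)) &
      continuous (fun p : G * X => a p.1 p.2)].

Definition Borel (X : ptopologicalType) := g_sigma_algebraType (@open X).

Definition regular_measure (R : realType) (X : ptopologicalType)
  (mu : set (Borel X) -> \bar R) : Prop :=
  forall A : set (Borel X), measurable A ->
    mu A = ereal_inf [set mu U | U in [set U : set X | open U /\ A `<=` U]] /\
    mu A = ereal_sup [set mu C | C in [set C : set X | compact C /\ C `<=` A]].

(* Amenability: every continuous action of G on a compact Hausdorff space
   admits an invariant regular Borel probability measure.  (Only nonempty
   spaces are considered: a probability measure needs a nonempty space.) *)
Definition amenable (R : realType) (G : topologicalType) (mul : G -> G -> G)
  (one : G) : Prop :=
  forall (X : ptopologicalType) (a : G -> X -> X),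
    compact [set: X] -> hausdorff_space X -> cont_action mul one a ->
    exists mu : probability (Borel X) R,
      regular_measure mu /\
      forall g (A : set (Borel X)), measurable A ->
        mu ((a g) @^-1` A) = mu A.

Definition supnorm (R : realType) (K : topologicalType) (f : K -> R) : R :=
  sup [set `|f x| | x in [set: K]].

Definition isometric_action (R : realType) (G : topologicalType)
  (mul : G -> G -> G) (one : G) (K : topologicalType)
  (T : G -> (K -> R) -> (K -> R)) : Prop :=
  [/\ (forall g f, continuous f -> continuous (T g f)),
      ((forall f, continuous f -> T one f = f) /\
      (forall g h f, continuous f -> T (mul g h) f = T g (T h f))),
      (forall g (c : R) f h, continuous f -> continuous h ->
          T g (fun x => c * f x + h x) = (fun x => c * T g f x + T g h x)),
      (forall g f, continuous f -> supnorm (T g f) = supnorm f) &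
      (forall (g0 : G) (f0 : K -> R) (e : R), continuous f0 -> 0 < e ->
         exists2 U, nbhs g0 U & exists2 d : R, 0 < d &
           forall g f, U g -> continuous f -> supnorm (fun x => f x - f0 x) < d ->
             supnorm (fun x => T g f x - T g0 f0 x) < e)].

(* alpha is the action on K induced via the Banach-Stone theorem:
   T g f (x) = psi_g(x) f(alpha g ^-1 (x)), with alpha g a homeomorphism
   and psi_g : K -> {-1,1} continuous.  Written with y = alpha g ^-1 x. *)
Definition induced_action (R : realType) (G : topologicalType) (K : topologicalType)
  (T : G -> (K -> R) -> (K -> R)) (alpha : G -> K -> K) : Prop :=
  forall g, exists (beta : K -> K) (psi : K -> R),
    [/\ (continuous (alpha g) /\ continuous beta), (cancel (alpha g) beta /\
        cancel beta (alpha g)), continuous psi,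
        (forall x, psi x = 1 \/ psi x = -1) &
        forall f, continuous f -> forall x, T g f x = psi x * f (beta x)].

Definition invariant_set (G : Type) (K : Type) (alpha : G -> K -> K) (M : set K) :=
  forall g x, M x -> M (alpha g x).

Definition minimal_subspace (G : Type) (K : topologicalType) (alpha : G -> K -> K)
  (M : set K) : Prop :=
  [/\ M !=set0, closed M, invariant_set alpha M &
      forall N : set K, N `<=` M -> N !=set0 -> closed N -> invariant_set alpha N ->
        N = M].

Definition metrizable (R : realType) (K : topologicalType) : Prop :=
  exists d : K -> K -> R,
    [/\ (forall x y, 0 <= d x y), (forall x y, d x y = 0 <-> x = y),
        (forall x y, d x y = d y x),
        (forall x y z, d x z <= d x y + d y z) &
        forall A : set K, open A <->
          (forall x, A x -> exists2 e : R, 0 < e & [set y | d x y < e] `<=` A)].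

Definition good_norm (R : realType) (G : Type) (K : topologicalType)
  (T : G -> (K -> R) -> (K -> R)) (N : (K -> R) -> R) : Prop :=
  [/\
      ((forall f, continuous f -> N f = 0 -> f = (fun _ => 0)) /\
      (forall (c : R) f, continuous f -> N (fun x => c * f x) = `|c| * N f)),
      ((forall f h, continuous f -> continuous h ->
          N (fun x => f x + h x) <= N f + N h) /\ (forall f, 0 <= N f)),
      (exists2 a : R, 0 < a & exists2 b : R, 0 < b &
         forall f, continuous f -> a * supnorm f <= N f /\ N f <= b * supnorm f),
      (forall g f, continuous f -> N (T g f) = N f) &
      (forall f h, continuous f -> continuous h -> f <> h -> N f = N h ->
          N (fun x => (f x + h x) / 2) < N f)].

(* Main.v *)
(** By Urysohn's lemma and the form of [T g], the map [alpha] is an action of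
    [G] on [K]; it is jointly continuous because [T (inv g) f] equals
    [f \o alpha g] up to sign.  Amenability gives an invariant probability
    measure on each minimal subspace [M].  It charges every open set [U]
    meeting [M], for by minimality and compactness finitely many translates of
    [U] cover [M].  In both cases countably many minimal subspaces have dense
    union (in the metrizable case, those through a countable dense set), so a
    geometric mixture [mu] of their measures is finite, invariant and of full
    support.  Then [supnorm f + sqrt (\int[mu]_x f x ^+ 2)] is the required
    norm: since [mu] has full support, equality in the Cauchy-Schwarz inequality
    forces proportionality everywhere, which gives strict convexity. *)
Require Import Defs.
From HB Require Import structures.
From mathcomp Require Import all_boot all_order all_algebra.
From mathcomp Require Import all_classical all_reals all_analysis.
From mathcomp Require Import measurable_realfun ring lra.
Import Order.TTheory GRing.Theory Num.Theory.
Import numFieldNormedType.Exports.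
Local Open Scope classical_set_scope.
Local Open Scope ring_scope.

(** * The sup norm *)

Section supnorm_theory.
Variables (R : realType) (K : topologicalType).
Implicit Types f h : K -> R.

Lemma supnorm_ge0 f : 0 <= supnorm f.
Proof.
rewrite /supnorm; set S := [set _ | _ in _].
(* [sup] takes the default value 0 when [S] is empty or unbounded above. *)
have [hS|hS] := pselect (has_sup S); last by rewrite sup_out.
have [y [x _ _]] := hS.1.
apply: le_trans (normr_ge0 (f x)) _.
by apply: ub_le_sup; [exact: hS.2|exists x].
Qed.

Lemma supnorm_le f (c : R) : 0 <= c -> (forall x, `|f x| <= c) -> supnorm f <= c.
Proof.
move=> c0 fc; rewrite /supnorm; set S := [set _ | _ in _].
have [hS|hS] := pselect (has_sup S); last by rewrite sup_out.
by apply: ge_sup => [|_ [x _ <-]//]; exact: hS.1.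
Qed.

Hypothesis cK : compact [set: K].

Lemma le_supnorm f x : continuous f -> `|f x| <= supnorm f.
Proof.
move=> cf; apply: ub_le_sup; last by exists x.
have : compact (f @` [set: K]).
  by apply: continuous_compact => //; exact: continuous_subspaceT.
move=> /compact_bounded[M [_ HM]].
exists (M + 1) => _ [y _ <-].
by apply: (HM (M + 1)); [rewrite ltrDl|exists y].
Qed.

Lemma supnormD f h : continuous f -> continuous h ->
  supnorm (fun x => f x + h x) <= supnorm f + supnorm h.
Proof.
move=> cf ch; apply: supnorm_le => [|x]; first by rewrite addr_ge0// supnorm_ge0.
by apply: (le_trans (ler_normD _ _)); apply: lerD; exact: le_supnorm.
Qed.

Lemma supnormZ (c : R) f : continuous f ->
  supnorm (fun x => c * f x) = `|c| * supnorm f.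
Proof.
move=> cf; apply/le_anti/andP; split.
  apply: supnorm_le => [|x]; first by rewrite mulr_ge0// supnorm_ge0.
  by rewrite normrM ler_wpM2l// le_supnorm.
have [->|c0] := eqVneq c 0; first by rewrite normr0 mul0r supnorm_ge0.
have c1 : 0 < `|c| by rewrite normr_gt0.
rewrite mulrC -ler_pdivlMr//; apply: supnorm_le => [|x].
  by rewrite divr_ge0// supnorm_ge0.
rewrite ler_pdivlMr// mulrC -normrM.
apply: (@le_supnorm (fun x => c * f x)).
by move=> y; apply: cvgM; [exact: cvg_cst|exact: cf].
Qed.

End supnorm_theory.

(** * Strictly convex norms from definite positive functionals *)

Section functional_norm.
Variables (R : realType) (K : topologicalType) (L : (K -> R) -> R).
Implicit Types f h : K -> R.
Hypothesis cK : compact [set: K].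
Hypothesis L_lin : forall (c : R) f h, continuous f -> continuous h ->
  L (fun x => c * f x + h x) = c * L f + L h.
Hypothesis L_mono : forall f h, continuous f -> continuous h ->
  (forall x, f x <= h x) -> L f <= L h.
Hypothesis L_definite : forall f, continuous f ->
  L (fun x => f x ^+ 2) = 0 -> f = (fun _ => 0).

(** With [L] as the integral, [q] and [p] are the squared [L^2] norm and the [L^2] norm. *)
Let q f := L (fun x => f x ^+ 2).
Let p f := Num.sqrt (q f).

Let ccst (c : R) : continuous (fun _ : K => c).
Proof. by move=> x; exact: cvg_cst. Qed.
Let cD f h : continuous f -> continuous h -> continuous (fun x => f x + h x).
Proof. by move=> cf ch x; apply: cvgD; [exact: cf|exact: ch]. Qed.
Let cM f h : continuous f -> continuous h -> continuous (fun x => f x * h x).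
Proof. by move=> cf ch x; apply: cvgM; [exact: cf|exact: ch]. Qed.

Let L0 : L (fun _ => 0) = 0.
Proof.
have := L_lin 1 (fun=> 0) (fun=> 0) (ccst 0) (ccst 0).
rewrite (_ : (fun _ : K => 1 * 0 + 0) = (fun _ => 0)); last by apply/funext => x; lra.
by move: (L _) => l; lra.
Qed.

Let LZ c f : continuous f -> L (fun x => c * f x) = c * L f.
Proof.
move=> cf; have := L_lin c f (fun=> 0) cf (ccst 0).
rewrite L0 addr0 => <-; congr L; by apply/funext => x; rewrite addr0.
Qed.

Let q_ge0 f : continuous f -> 0 <= q f.
Proof.
move=> cf; rewrite -L0; apply: L_mono => //; first exact: cM.
by move=> x; rewrite sqr_ge0.
Qed.

Let qE a b f h : continuous f -> continuous h ->
  q (fun x => a * f x + b * h x)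
  = a ^+ 2 * q f + (2 * a * b) * L (fun x => f x * h x) + b ^+ 2 * q h.
Proof.
move=> cf ch; rewrite /q.
rewrite (_ : (fun x => (_ + _) ^+ 2) = (fun x => a ^+ 2 * (f x * f x) +
   ((2 * a * b) * (f x * h x) + b ^+ 2 * (h x * h x)))); last first.
  by apply/funext => x; ring.
have cff := cM f f cf cf; have cfh := cM f h cf ch; have chh := cM h h ch ch.
have cb : continuous (fun x => b ^+ 2 * (h x * h x)) by exact: cM.
rewrite !L_lin// ?LZ ?addrA//.
by apply: cD => //; exact: cM.
Qed.

Let pp f : continuous f -> p f ^+ 2 = q f.
Proof. by move=> cf; rewrite sqr_sqrtr// q_ge0. Qed.

Let pZ c f : continuous f -> p (fun x => c * f x) = `|c| * p f.
Proof.
move=> cf; rewrite /p /q.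
rewrite (_ : (fun x => (c * f x) ^+ 2) = (fun x => c ^+ 2 * (f x * f x))); last first.
  by apply/funext => x; ring.
by rewrite LZ; [rewrite sqrtrM ?sqr_ge0// sqrtr_sqr|exact: cM].
Qed.

Let p_eq0 f : continuous f -> p f = 0 -> f = (fun _ => 0).
Proof. by move=> cf pf; apply: L_definite => //; rewrite -/(q f) -pp// pf expr0n. Qed.

Let p_ge0 f : 0 <= p f.
Proof. exact: sqrtr_ge0. Qed.

Let pD_sqr f h : continuous f -> continuous h ->
  p (fun x => f x + h x) ^+ 2 = p f ^+ 2 + 2 * L (fun x => f x * h x) + p h ^+ 2.
Proof.
move=> cf ch; rewrite !pp//; last exact: cD.
have := qE 1 1 f h cf ch; rewrite !(expr1n, mul1r, mulr1) => <-.
by congr q; apply/funext => x; rewrite !mul1r.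
Qed.

(** These coefficients make the quadratic form a multiple of the Cauchy-Schwarz defect: its sign
    gives the inequality, its vanishing the equality case. *)
Let cauchy_schwarz_gap f h : continuous f -> continuous h ->
  q (fun x => p h * f x + - p f * h x) =
  2 * (p f * p h) * (p f * p h - L (fun x => f x * h x)).
Proof. by move=> cf ch; rewrite qE// -!pp//; ring. Qed.

Let L_le f h : continuous f -> continuous h -> L (fun x => f x * h x) <= p f * p h.
Proof.
move=> cf ch.
have [pf0|pf0] := eqVneq (p f) 0.
  rewrite pf0 mul0r (p_eq0 f cf pf0).
  rewrite (_ : (fun x => _) = (fun=> 0)) ?L0//; by apply/funext => x; rewrite mul0r.
have [ph0|ph0] := eqVneq (p h) 0.
  rewrite ph0 mulr0 (p_eq0 h ch ph0).
  rewrite (_ : (fun x => _) = (fun=> 0)) ?L0//; by apply/funext => x; rewrite mulr0.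
have pf1 : 0 < p f by rewrite lt_def pf0 p_ge0.
have ph1 : 0 < p h by rewrite lt_def ph0 p_ge0.
have : 0 <= q (fun x => p h * f x + - p f * h x).
  by apply: q_ge0; apply: cD; exact: cM.
by rewrite cauchy_schwarz_gap// pmulr_rge0 ?subr_ge0// mulr_gt0// mulr_gt0.
Qed.

Let pD f h : continuous f -> continuous h -> p (fun x => f x + h x) <= p f + p h.
Proof.
move=> cf ch; rewrite -(ler_pXn2r (n := 2))// ?nnegrE ?addr_ge0 ?p_ge0//.
by rewrite pD_sqr//; have := L_le f h cf ch; lra.
Qed.

(** Equality in the triangle inequality forces equality in Cauchy-Schwarz, so the gap vanishes and
    definiteness applies. *)
Let pD_eq f h : continuous f -> continuous h -> p (fun x => f x + h x) = p f + p h ->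
  forall x, p h * f x = p f * h x.
Proof.
move=> cf ch e x.
have eL : L (fun x => f x * h x) = p f * p h.
  by have := pD_sqr f h cf ch; rewrite e; lra.
have c0 : continuous (fun x => p h * f x + - p f * h x).
  by apply: cD; exact: cM.
have := cauchy_schwarz_gap f h cf ch; rewrite eL subrr mulr0 => /(L_definite _ c0).
by move=> /(congr1 (fun u => u x)); lra.
Qed.

(** The sup norm supplies equivalence with the original norm, and [p] supplies strict convexity,
    which survives adding another norm. *)
Lemma functional_good_norm (G : Type) (T : G -> (K -> R) -> (K -> R)) :
  (forall g f, continuous f -> supnorm (T g f) = supnorm f) ->
  (forall g f, continuous f ->
    L (fun x => T g f x ^+ 2) = L (fun x => f x ^+ 2)) ->
  good_norm T (fun f => supnorm f + Num.sqrt (L (fun x => f x ^+ 2))).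
Proof.
move=> Tsup TL; rewrite -/p.
pose N f := supnorm f + p f.
have N0 f : continuous f -> N f = 0 -> f = (fun _ => 0).
  move=> cf Nf; apply: p_eq0 => //; move: Nf (supnorm_ge0 _ _ f) (p_ge0 f).
  by rewrite /N; lra.
have NZ c f : continuous f -> N (fun x => c * f x) = `|c| * N f.
  by move=> cf; rewrite /N supnormZ// pZ// mulrDr.
split.
- by split.
- split=> [f h cf ch|f]; last by rewrite addr_ge0 ?supnorm_ge0 ?p_ge0.
  by rewrite addrACA lerD ?supnormD ?pD.
(* The upper constant comes from [f x ^+ 2 <= supnorm f ^+ 2] and monotonicity of [L]. *)
- exists 1 => //; exists (1 + Num.sqrt (L (fun=> 1))).
    by rewrite ltr_pwDl// sqrtr_ge0.
  move=> f cf; split; first by rewrite mul1r lerDl sqrtr_ge0.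
  rewrite mulrDl mul1r lerD2l.
  rewrite -[X in _ * X]ger0_norm ?supnorm_ge0// -sqrtr_sqr mulrC -sqrtrM ?sqr_ge0//.
  apply: ler_wsqrtr; rewrite -LZ//; apply: L_mono; [exact: cM|exact: cM|].
  by move=> x; rewrite mulr1 -(@real_normK _ (f x)) ?num_real// lerXn2r ?nnegrE ?supnorm_ge0// le_supnorm.
- by move=> g f cf; rewrite Tsup// TL.
- move=> f h cf ch fh; rewrite -/(N f) -/(N h) => Nfh.
  have -> : supnorm (fun x => (f x + h x) / 2) + Num.sqrt (L (fun x => ((f x + h x) / 2) ^+ 2))
    = (supnorm (fun x => f x + h x) + p (fun x => f x + h x)) / 2.
    have := NZ 2^-1 (fun x => f x + h x) (cD _ _ cf ch).
    rewrite (_ : (fun x => 2^-1 * _) = (fun x => (f x + h x) / 2)); last first.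
      by apply/funext => x; rewrite mulrC.
    by rewrite /N /p /q ger0_norm// mulrC => ->.
  have le1 := supnormD _ _ cK f h cf ch.
  have le2 := pD f h cf ch.
  (* A strict triangle inequality for [p] already makes the one for the sum strict; otherwise [f]
     and [h] are proportional. *)
  have [lt2|ge2] := ltP (p (fun x => f x + h x)) (p f + p h).
    by move: Nfh; rewrite /N; lra.
  have e2 := le_anti (introT andP (conj le2 ge2)).
  have prop := pD_eq f h cf ch e2.
  exfalso; apply: fh.
  (* Applying [N] to both sides of the proportionality, with [N f = N h], leaves [p h = p f] or
     [N f = 0]; either one yields [f = h]. *)
  have : p h * N f = p f * N h.
    rewrite -[p h]ger0_norm ?p_ge0// -[p f]ger0_norm ?p_ge0// -!NZ//.
    by congr N; apply/funext => x; exact: prop.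
  rewrite -Nfh => /eqP; rewrite -subr_eq0 -mulrBl mulf_eq0 subr_eq0 => /orP[/eqP e|/eqP N0f].
    have [pf0|pf0] := eqVneq (p f) 0.
      by rewrite (p_eq0 f)// (p_eq0 h)// e.
    by apply/funext => x; have := prop x; rewrite e => /(mulfI pf0).
  by rewrite (N0 f)// (N0 h)// -Nfh.
Qed.

End functional_norm.

(** * Integration against invariant measures of full support *)

Lemma open_measurable_Borel (X : ptopologicalType) (U : set X) :
  open U -> measurable (U : set (Borel X)).
Proof. by move=> oU; exact: sub_gen_smallest. Qed.

Lemma continuous_measurable_Borel (X Y : ptopologicalType) (f : X -> Y) :
  continuous f -> measurable_fun [set: Borel X] (f : Borel X -> Borel Y).
Proof.
move=> /continuousP cf; apply: (@measurability _ _ _ (Borel Y) _ _ (@open Y)) => //.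
by move=> _ [U oU <-]; rewrite setTI; apply: open_measurable_Borel; exact: cf.
Qed.

Lemma continuous_measurable_real (R : realType) (X : ptopologicalType) (f : X -> R) :
  continuous f -> measurable_fun [set: Borel X] (f : Borel X -> R).
Proof.
move=> /continuousP cf; apply: (measurability _ (RGenOpens.measurableE R)).
move=> _ [_ [a [b ->] <-]]; rewrite setTI; apply: open_measurable_Borel.
by apply: cf; exact: interval_open.
Qed.

Section full_support_measure.
Variables (R : realType) (K : ptopologicalType) (mu : {measure set (Borel K) -> \bar R}).
Hypothesis cK : compact [set: K].
Hypothesis mu_fin : (mu setT < +oo)%E.
Hypothesis mu_pos : forall U : set K, open U -> U !=set0 -> (0 < mu U)%E.

Lemma continuous_integrable (f : K -> R) : continuous f ->
  mu.-integrable setT (EFin \o (f : Borel K -> R)).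
Proof.
move=> cf; apply: measurable_bounded_integrable => //.
  exact: continuous_measurable_real.
exists (supnorm f); split; first exact: num_real.
by move=> M ltM x _; apply: le_trans (le_supnorm _ _ cK f x cf) (ltW ltM).
Qed.

(** The set where [f] is nonzero is open and null, hence empty by full support. *)
Lemma Rintegral_sqr_eq0 (f : K -> R) : continuous f ->
  \int[mu]_x (f x ^+ 2) = 0 -> f = (fun _ => 0).
Proof.
move=> cf I0; apply/funext => x0; apply: contrapT => fx0.
have cf2 : continuous (fun x => f x ^+ 2).
  by move=> x; apply: cvgM; exact: cf.
have mf2 := continuous_measurable_real _ _ _ cf2.
(* The real integral is [fine] of the extended one, so integrability is needed to exclude an
   infinite value sent to 0. *)
have : (\int[mu]_x `|(f x ^+ 2)%:E| = 0)%E.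
  transitivity (\int[mu]_x (f x ^+ 2)%:E)%E.
    by apply: eq_integral => x _; rewrite gee0_abs// lee_fin sqr_ge0.
  rewrite -(@fineK _ (\int[mu]_x (f x ^+ 2)%:E)%E); first by congr EFin.
  exact: integrable_fin_num (continuous_integrable _ cf2).
move=> /ae_eq_integral_abs; case=> //; first exact/measurable_EFinP.
move=> A [mA muA0 subA].
pose U := [set x | f x != 0].
have oU : open U.
  by move/continuousP: cf => /(_ [set y | y != 0]); apply; exact: open_neq.
have UA : U `<=` A.
  move=> x /= Ux; apply: subA => /=.
  move=> /(_ I) [] /eqP; rewrite expf_eq0/=; exact/negP.
have : (mu U <= mu A)%E.
  by apply: le_measure; rewrite ?inE//; exact: open_measurable_Borel.
rewrite muA0 leNgt mu_pos//; by exists x0; apply/eqP.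
Qed.

Lemma Rintegral_invariant (b : K -> K) (f : K -> R) :
  continuous b -> (forall A : set (Borel K), measurable A -> mu (b @^-1` A) = mu A) ->
  continuous f -> (forall x, 0 <= f x) ->
  \int[mu]_x f (b x) = \int[mu]_x f x.
Proof.
move=> cb mub cf f0; rewrite /Rintegral; congr fine.
have mb := continuous_measurable_Borel _ _ _ cb.
have mf := continuous_measurable_real _ _ _ cf.
transitivity (\int[mu]_(x in b @^-1` setT) ((EFin \o f) \o b) x)%E => //.
rewrite -(ge0_integral_pushforward mb)//; first last.
- by move=> y _; rewrite lee_fin.
- exact/measurable_EFinP.
by apply: eq_measure_integral => A mA _; exact: mub.
Qed.

(** The functional is integration against [mu]: squaring removes the sign [psi], and invariance of
    [mu] removes [b]. *)
Lemma invariant_measure_good_norm (G : Type) (T : G -> (K -> R) -> (K -> R)) :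
  (forall g f, continuous f -> supnorm (T g f) = supnorm f) ->
  (forall g, exists (b : K -> K) (psi : K -> R),
    [/\ continuous b,
        forall A : set (Borel K), measurable A -> mu (b @^-1` A) = mu A,
        forall x, psi x = 1 \/ psi x = -1 &
        forall f, continuous f -> forall x, T g f x = psi x * f (b x)]) ->
  exists N, good_norm T N.
Proof.
move=> Tsup Tform.
exists (fun f => supnorm f + Num.sqrt (\int[mu]_x (f x ^+ 2))).
apply: (functional_good_norm _ _ (fun f => \int[mu]_x f x)) => //.
- move=> c f h cf ch; rewrite RintegralD//; last exact: continuous_integrable.
    rewrite RintegralZl//; exact: continuous_integrable.
  apply: (continuous_integrable (fun x => c * f x)).
  by move=> x; apply: cvgM; [exact: cvg_cst|exact: cf].
- by move=> f h cf ch fh; apply: le_Rintegral => //; exact: continuous_integrable.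
- exact: Rintegral_sqr_eq0.
- move=> g f cf; have [b [psi [cb mub psi1 Tg]]] := Tform g.
  have cf2 : continuous (fun x => f x ^+ 2) by move=> x; apply: cvgM; exact: cf.
  rewrite -(Rintegral_invariant _ _ cb mub cf2); last by move=> x; exact: sqr_ge0.
  apply: eq_Rintegral => x _; rewrite Tg// exprMn.
  by have [->|->] := psi1 x; rewrite ?sqrrN expr1n mul1r.
Qed.

End full_support_measure.

(** * The action induced on [K] *)

Lemma urysohn_point (R : realType) (K : topologicalType) (x : K) (B : set K) :
  compact [set: K] -> hausdorff_space K -> closed B -> ~ B x ->
  exists f : K -> R, [/\ continuous f, f x = 1 & forall y, B y -> f y = 0].
Proof.
move=> cK hK cB nBx.
have [|||f [cf fB fx _]] := @urysohn_ext_itv _ R (compact_normal hK cK) B [set x] 0 1 cB.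
- exact: accessible_closed_set1 (hausdorff_accessible hK) _.
- by apply/seteqP; split => // y [By yx]; apply: nBx; rewrite -yx.
- exact: ltr01.
exists f; split => // [|y By]; first by apply: fx; exists x.
by apply: fB; exists y.
Qed.

(** Absolute values appear because [T] determines [f \o alpha g] only up to sign; a Urysohn function
    with values 1 and 0 still separates the points. *)
Lemma continuous_normr_inj (R : realType) (K : topologicalType) (x y : K) :
  compact [set: K] -> hausdorff_space K ->
  (forall f : K -> R, continuous f -> `|f x| = `|f y|) -> x = y.
Proof.
move=> cK hK fxy; apply: contrapT => xy.
have cy : closed [set y] by exact: accessible_closed_set1 (hausdorff_accessible hK) _.
have [f [cf fx fy]] := @urysohn_point R K x [set y] cK hK cy xy.
by have := fxy f cf; rewrite fx fy// normr1 normr0 => /eqP; rewrite oner_eq0.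
Qed.

Section induced_action.
Variables (R : realType) (G : topologicalType) (mul : G -> G -> G) (inv : G -> G)
  (one : G) (K : topologicalType) (T : G -> (K -> R) -> (K -> R)) (alpha : G -> K -> K).
Hypothesis topG : is_topgroup mul inv one.
Hypotheses (cK : compact [set: K]) (hK : hausdorff_space K).
Hypotheses (isoT : isometric_action mul one T) (indT : induced_action T alpha).

Lemma normr_induced_action g (f : K -> R) x : continuous f ->
  `|T g f (alpha g x)| = `|f x|.
Proof.
move=> cf; have [b [psi [_ [ab _] _ psi1 ->//]]] := indT g.
by rewrite ab normrM; have [->|->] := psi1 (alpha g x); rewrite ?normrN normr1 mul1r.
Qed.

Lemma induced_action1 x : alpha one x = x.
Proof.
have [_ [T1 _] _ _ _] := isoT.
apply: (@continuous_normr_inj R _ _ _ cK hK) => f cf.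
by rewrite -[RHS](normr_induced_action one)// T1.
Qed.

Lemma induced_actionM g h x : alpha (mul g h) x = alpha g (alpha h x).
Proof.
have [Tc [_ TM] _ _ _] := isoT.
have [b [_ [_ [ab ba] _ _ _]]] := indT (mul g h).
(* Pulling back by [b], the inverse of [alpha (mul g h)], leaves a comparison of [x] with
   [b (alpha g (alpha h x))]. *)
apply: (can_inj ba); rewrite ab.
apply: (@continuous_normr_inj R _ _ _ cK hK) => f cf.
rewrite -[RHS](normr_induced_action (mul g h))// ba TM//.
by rewrite !normr_induced_action//; exact: Tc.
Qed.

(* Up to sign, [T (inv g) f] is [f \o alpha g]; the former depends continuously on [g] in sup norm. *)
Lemma induced_action_continuous : continuous (fun p : G * K => alpha p.1 p.2).
Proof.
have [_ _ invG _ cinv] := topG.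
have [Tc _ _ _ Tcont] := isoT.
have TV g f x : continuous f -> `|T (inv g) f x| = `|f (alpha g x)|.
  move=> cf; rewrite -[RHS](normr_induced_action (inv g))// -induced_actionM.
  by rewrite (invG g).1 induced_action1.
move=> [g0 x0] /= V; rewrite nbhsE => -[W [oW Wy0] WV].
have cW : closed (~` W) by rewrite closedC.
have [|f [cf f1 f0]] := @urysohn_point R K (alpha g0 x0) (~` W) cK hK cW; first exact.
have half0 : 0 < 2^-1 :> R by rewrite invr_gt0.
have [U nU [d d0 TU]] := Tcont (inv g0) f 2^-1 cf half0.
have cTf : continuous (T (inv g0) f) by exact: Tc.
(* Where [T (inv g0) f] exceeds 1/2 in absolute value, moving it by less than 1/2 cannot give 0; so
   [f (alpha g x)] is nonzero and [alpha g x] lies in [W]. *)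
have nW : nbhs x0 [set x | 2^-1 < `|T (inv g0) f x|].
  have c1 : continuous (fun x => `|T (inv g0) f x|).
    by move=> x; apply: cvg_norm; exact: cTf.
  apply: (c1 x0 [set y | 2^-1 < y]).
  apply: open_nbhs_nbhs; split; first exact: open_gt.
  by rewrite /= TV// f1 normr1; lra.
exists (inv @^-1` U, [set x | 2^-1 < `|T (inv g0) f x|]).
  by split => //; exact: cinv.
move=> [g x] [/= Ug Tx]; apply: WV; apply: contrapT => /f0 fgx.
have : `|T (inv g) f x - T (inv g0) f x| < 2^-1.
  apply: le_lt_trans (TU (inv g) f Ug cf _).
    apply: (le_supnorm _ _ cK (fun x => T (inv g) f x - T (inv g0) f x)).
    by move=> y; apply: cvgB; [exact: Tc|exact: cTf].
  apply: le_lt_trans d0; apply: supnorm_le => // y.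
  by rewrite subrr normr0.
have /eqP : `|T (inv g) f x| = 0 by rewrite TV// fgx normr0.
by rewrite normr_eq0 => /eqP ->; rewrite sub0r normrN; lra.
Qed.

Lemma induced_cont_action : cont_action mul one alpha.
Proof.
split; [exact: induced_action1|exact: induced_actionM|].
exact: induced_action_continuous.
Qed.

End induced_action.

(* [Borel] and [amenable] only apply to spaces with a distinguished point. *)
Definition pointed_at (X : topologicalType) (p : X) : Type := X.
HB.instance Definition _ (X : topologicalType) (p : X) :=
  Topological.on (pointed_at X p).
HB.instance Definition _ (X : topologicalType) (p : X) :=
  isPointed.Build (pointed_at X p) p.

Lemma cont_action_continuous (G : topologicalType) (mul : G -> G -> G) (one : G)
    (X : topologicalType) (a : G -> X -> X) :
  cont_action mul one a -> forall g, continuous (a g).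
Proof.
move=> [_ _ acont] g x.
apply: (@continuous_comp _ _ _ (fun y => (g, y)) (fun p : G * X => a p.1 p.2)).
  by apply: cvg_pair; [exact: cvg_cst|exact: cvg_id].
exact: acont.
Qed.

(** Compactness leaves a finite union of null sets, so [I] may be uncountable; it will be the group
    [G]. *)
Lemma compact_null_cover (R : realType) (X : ptopologicalType)
    (mu : {measure set (Borel X) -> \bar R}) (I : choiceType) (f : I -> set X) :
  compact [set: X] -> (forall i, open (f i)) -> (forall i, mu (f i) = 0%E) ->
  (forall x, exists i, f i x) -> mu setT = 0%E.
Proof.
rewrite compact_cover => cX of_ f0 cov.
have [x _|D _ fD] := cX I setT f (fun i _ => of_ i).
  by have [i fix_] := cov x; exists i.
apply/(@negligibleP _ (Borel X)) => //.
apply: (@negligibleS _ (Borel X) _ mu _ _ fD); rewrite /cover bigcup_fset.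
elim/big_ind : _ => [|A B|i _]; [exact: (@negligible_set0 _ (Borel X))|exact: (@negligibleU _ (Borel X))|].
by apply/(@negligibleP _ (Borel X) _ _ _ (open_measurable_Borel _ _ (of_ i))); exact: f0.
Qed.

(** * Invariant measures on minimal subspaces *)

Section minimal_measure.
Variables (R : realType) (G : topologicalType) (mul : G -> G -> G) (one : G)
  (K : ptopologicalType) (alpha : G -> K -> K).
Hypotheses (cK : compact [set: K]) (hK : hausdorff_space K).
Hypotheses (ca : cont_action mul one alpha) (amG : amenable R mul one).

(** Amenability will be applied to [M] as a space in its own right. A filter on it is pushed to [K],
    where it clusters in [M]. *)
Lemma closed_set_type_compact (M : set K) : closed M -> compact [set: set_type M].
Proof.
move=> cM F FF _.
have cM' : compact M by apply: (subclosed_compact cM cK).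
have [|x [Mx Fx]] := cM' (set_val @ F) _.
  by rewrite nbhs_simpl; apply: (@filterS _ F _ setT) => [x _|]; [exact: set_valP|exact: filterT].
exists (exist _ x (mem_set Mx)); split => // A B FA.
move=> [_ [[C oC <-] Cx CB]].
have FA' : F (set_val @^-1` (set_val @` A)).
  by apply: filterS FA => y Ay; exists y.
have [_ [[y Ay <-] Cy]] := Fx _ C FA' (open_nbhs_nbhs (conj oC Cx)).
by exists y; split => //; exact: CB.
Qed.

Lemma set_type_hausdorff (M : set K) : hausdorff_space (set_type M).
Proof.
move=> x y xy; apply: val_inj; apply: hK => A B nA nB.
have [z [Az Bz]] := xy (set_val @^-1` A) (set_val @^-1` B)
  (@initial_continuous _ _ set_val x A nA) (@initial_continuous _ _ set_val y B nB).
by exists (set_val z).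
Qed.

(** The points of [M] whose orbit avoids [U] form a closed invariant set. If nonempty it is all of
    [M], yet a point of [M] in [U] is excluded from it by [one]. *)
Lemma minimal_orbit_meets_open (M U : set K) : minimal_subspace alpha M ->
  open U -> M `&` U !=set0 -> forall x, M x -> exists g, U (alpha g x).
Proof.
move=> [M0 cM iM minM] oU [y [My Uy]] x Mx; apply: contrapT => nU.
have [a1 aM acont] := ca.
pose N := M `&` [set z | forall g, ~ U (alpha g z)].
have cg g : continuous (alpha g) by exact: cont_action_continuous _ _ _ _ _ ca g.
have NM : N = M.
  apply: minM.
  - by move=> z [].
  - by exists x; split => // g Ug; apply: nU; exists g.
  - apply: closedI => //.
    rewrite (_ : [set z | _] = \bigcap_g (alpha g @^-1` (~` U))).
      apply: closed_bigI => g _; apply: preimage_closed => //.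
      by rewrite closedC.
    by apply/seteqP; split => z h g; [move=> _; exact: h|exact: (h g I)].
  - move=> g z [Mz hz]; split; first exact: iM.
    by move=> h; rewrite -aM; exact: hz.
have [_ /(_ one)] : N y by rewrite NM.
by rewrite a1; exact.
Qed.

(** [nu] is the image under the inclusion of the measure that amenability gives on [M]. If [U] were
    null, so would be its translates, which cover [M], against total mass 1. *)
Lemma minimal_subspace_measure (M : set K) : minimal_subspace alpha M ->
  exists nu : {measure set (Borel K) -> \bar R},
  [/\ (nu setT = 1)%E,
      forall g (A : set (Borel K)), measurable A -> nu (alpha g @^-1` A) = nu A &
      forall U : set K, open U -> M `&` U !=set0 -> (0 < nu U)%E].
Proof.
move=> minM; have [[p Mp] cM iM _] := minM.
have [a1 aM acont] := ca.
pose X : ptopologicalType := pointed_at (set_type M) (exist _ p (mem_set Mp)).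
pose i : X -> K := set_val.
have ci : continuous i by exact: initial_continuous.
have Mi x : M (i x) by exact: set_valP.
pose a g (x : X) : X := exist _ (alpha g (i x)) (mem_set (iM g _ (Mi x))).
have caX : cont_action mul one a.
  split.
  - by move=> x; apply: val_inj; exact: a1.
  - by move=> g h x; apply: val_inj; exact: aM.
  - apply: continuous_comp_initial => -[g x].
    apply: (@continuous_comp _ _ _ (fun p : G * X => (p.1, i p.2))
      (fun p : G * K => alpha p.1 p.2)); last exact: acont.
    by apply: cvg_pair; [exact: cvg_fst|apply: (cvg_comp _ _ cvg_snd); exact: ci].
have [mu [_ mu_inv]] := amG X a (closed_set_type_compact _ cM)
  (set_type_hausdorff M) caX.
have mi := continuous_measurable_Borel _ _ _ ci.
exists (distribution mu (mfun_Sub (mem_set mi))); split.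
- exact: (probability_setT mu).
- move=> g A mA; apply: (mu_inv g (i @^-1` A)).
  by rewrite -[X in measurable X]setTI; exact: mi.
move=> U oU MU; rewrite lt_def measure_ge0 andbT; apply/negP => /eqP mu0.
have {}mu0 : mu (i @^-1` U) = 0%E by [].
pose f g := a g @^-1` (i @^-1` U).
have of_ g : open (f g).
  rewrite /f -comp_preimage; apply: open_comp => // x _.
  apply: (@continuous_comp _ _ _ i (alpha g)); [exact: ci|].
  exact: cont_action_continuous _ _ _ _ _ ca g _.
have f0 g : mu (f g) = 0%E.
  apply: eq_trans mu0; apply: (mu_inv g (i @^-1` U)); apply: open_measurable_Borel.
  by apply: open_comp => // x _; exact: ci.
have mu00 := compact_null_cover R X mu G f (closed_set_type_compact _ cM) of_ f0
  (fun x => minimal_orbit_meets_open _ _ minM oU MU (i x) (Mi x)).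
by have /eqP := etrans (esym (probability_setT mu)) mu00; rewrite onee_eq0.
Qed.

End minimal_measure.

(** * Sequences of minimal subspaces with dense union *)

Lemma metrizable_dense_sequence (R : realType) (K : ptopologicalType) :
  compact [set: K] -> metrizable R K ->
  exists s : nat -> K, forall U : set K, open U -> U !=set0 -> exists n, U (s n).
Proof.
rewrite compact_cover => cK [d [d0 dE dC dT dopen]].
pose B n x := [set y | d x y < n.+1%:R^-1].
have oB n x : open (B n x).
  apply/dopen => y Bxy; exists (n.+1%:R^-1 - d x y); first by rewrite subr_gt0.
  by move=> z /= dyz; apply: (le_lt_trans (dT x y z)); rewrite -ltrBrDl.
have net n : exists D : seq K, forall y, exists2 x, x \in D & d x y < n.+1%:R^-1.
  have [y _|D _ BD] := cK K setT (B n) (fun x _ => oB n x).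
    by exists y => //; rewrite /B/= (iffRL (dE y y) erefl) invr_gt0.
  by exists (finmap.enum_fset D) => y; have [x Dx Bxy] := BD y I; exists x.
have [D netD] := choice net.
(* [s] runs through all the finite nets: [m] codes a net and a position in it, and other [m] give
   [point]. *)
pose s m := if unpickle m is Some nk then nth point (D nk.1) nk.2 else point.
exists s => U /dopen oU [y Uy]; have [e e0 eU] := oU y Uy.
have [n] := ltr_add_invr e0; rewrite add0r => ne.
have [x Dx dxy] := netD n y.
exists (pickle (n, index x (D n))); rewrite /s pickleK /= nth_index//.
by apply: eU; rewrite /= dC; exact: lt_trans ne.
Qed.

(** Both cases of the theorem reduce to this form; repetitions are allowed, so a finite family also
    yields a sequence. *)
Definition dense_sequence_of_minimal_subspaces (G : Type) (K : topologicalType)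
    (alpha : G -> K -> K) (M : nat -> set K) :=
  (forall n, minimal_subspace alpha (M n)) /\
  (forall U : set K, open U -> U !=set0 -> exists n, M n `&` U !=set0).

Lemma finite_union_dense_sequence (G : Type) (K : ptopologicalType)
    (alpha : G -> K -> K) (n : nat) (M : 'I_n -> set K) :
  (forall i, minimal_subspace alpha (M i)) ->
  \bigcup_(i in [set: 'I_n]) M i = [set: K] ->
  exists A, dense_sequence_of_minimal_subspaces G K alpha A.
Proof.
move=> minM covM.
have cov x : exists i, M i x.
  by have [i _ Mx] : (\bigcup_(i in [set: 'I_n]) M i) x; [rewrite covM|exists i].
have [i0 _] := cov point.
(* Indices [m >= n] repeat [M i0], which exists because [K] has a point. *)
exists (fun m => if insub m is Some i then M i else M i0); split=> [m|U oU [y Uy]].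
  by case: insubP.
have [i Mi] := cov y.
by exists i; rewrite valK; exists y.
Qed.

Lemma metrizable_union_dense_sequence (R : realType) (G : Type) (K : ptopologicalType)
    (alpha : G -> K -> K) (I : Type) (M : I -> set K) :
  compact [set: K] -> metrizable R K ->
  (forall i, minimal_subspace alpha (M i)) ->
  \bigcup_(i in [set: I]) M i = [set: K] ->
  exists A, dense_sequence_of_minimal_subspaces G K alpha A.
Proof.
move=> cK metK minM covM.
have [s sdense] := metrizable_dense_sequence R K cK metK.
have : forall m, exists A, minimal_subspace alpha A /\ A (s m).
  move=> m; have [i _ Mi] : (\bigcup_(i in [set: I]) M i) (s m) by rewrite covM.
  by exists (M i).
move=> /choice[A hA]; exists A; split=> [m|U oU U0]; first exact: (hA m).1.
have [m Usm] := sdense U oU U0.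
by exists m, (s m); split => //; exact: (hA m).2.
Qed.

(** * Mixtures of countably many probability measures *)

Section geometric_mixture.
Variables (R : realType) (d : measure_display) (X : measurableType d).
Variable nu : nat -> {measure set X -> \bar R}.

(** The weights [2^-(k+1)] are positive, so every [nu k] contributes, and have sum 1, so the mixture
    is finite. *)
Let c (k : nat) : {nonneg R} := NngNum (divr_ge0 ler01 (ler0n R (2 ^ (k + 1)))).

Let mu : {measure set X -> \bar R} := mseries (fun k => mscale (c k) (nu k)) 0.

(** The last clause transfers invariance from the [nu n] to [mu], by taking for [A] a preimage of
    [B]. *)
Lemma geometric_mixture : (forall n, nu n setT = 1%E) ->
  exists mu : {measure set X -> \bar R},
  [/\ (mu setT < +oo)%E,
      forall n A, measurable A -> (0 < nu n A)%E -> (0 < mu A)%E &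
      forall A B, (forall n, nu n A = nu n B) -> mu A = mu B].
Proof.
move=> nu1; exists mu; split.
- rewrite (_ : mu setT = (\sum_(0 <= k <oo) (1 / (2 ^ (k + 1))%:R)%:E)%E); last first.
    apply: eq_eseriesr => k _; rewrite -[RHS]mule1 -(nu1 k) //.
  have /cvg_lim -> // := @cvg_geometric_eseries_half R 1 0.
  by rewrite expr0 divr1 ltry.
- move=> n A mA nuA.
  have t0 k : (0 <= mscale (c k) (nu k) A)%E by exact: measure_ge0.
  apply: (@lt_le_trans _ _ (\sum_(0 <= k < n.+1) mscale (c k) (nu k) A)%E); last first.
    exact: nneseries_lim_ge.
  rewrite big_nat_recr//=; apply: (@lt_le_trans _ _ (mscale (c n) (nu n) A)).
    by rewrite /mscale mule_gt0// lte_fin divr_gt0// ltr0n expn_gt0.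
  by rewrite leeDr// sume_ge0.
- move=> A B AB; apply: eq_eseriesr => n _.
  by rewrite /= /mscale AB.
Qed.

End geometric_mixture.

(** * Construction of the norm *)

Lemma dense_minimal_good_norm (R : realType) (G : topologicalType)
    (mul : G -> G -> G) (inv : G -> G) (one : G)
    (K : ptopologicalType) (T : G -> (K -> R) -> (K -> R)) (alpha : G -> K -> K)
    (M : nat -> set K) :
  is_topgroup mul inv one -> amenable R mul one ->
  compact [set: K] -> hausdorff_space K ->
  isometric_action mul one T -> induced_action T alpha ->
  dense_sequence_of_minimal_subspaces G K alpha M ->
  exists N : (K -> R) -> R, good_norm T N.
Proof.
move=> topG amG cK hK isoT indT [minM denseM].
have ca := induced_cont_action _ _ _ _ _ _ _ _ topG cK hK isoT indT.
have /choice[nu nuP] :=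
  fun n => minimal_subspace_measure _ _ _ _ _ _ cK hK ca amG (M n) (minM n).
have [|mu [mu_fin mu_pos mu_ext]] := geometric_mixture R _ (Borel K) nu.
  by move=> n; have [] := nuP n.
have [_ _ _ Tsup _] := isoT.
apply: (invariant_measure_good_norm R K mu cK mu_fin) => //.
  move=> U oU /(denseM U oU)[n MU]; apply: (mu_pos n).
    exact: open_measurable_Borel.
  by have [_ _] := nuP n; exact.
move=> g; have [b [psi [[_ cb] [ab _] _ psi1 Tg]]] := indT g.
exists b, psi; split => // A mA; apply: mu_ext => n.
have [_ nu_inv _] := nuP n.
(* [T g] composes with [b], the inverse of [alpha g], while [nu n] is invariant under [alpha g];
   taking one more preimage by [alpha g] cancels [b]. *)
rewrite -(nu_inv g); last first.
  rewrite -[X in measurable X]setTI.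
  exact: (continuous_measurable_Borel _ _ _ cb).
by congr (nu n _); apply/seteqP; split => x /=; rewrite ab.
Qed.

Theorem theorem6p1 (R : realType) (G : topologicalType)
  (mul : G -> G -> G) (inv : G -> G) (one : G)
  (K : topologicalType) (T : G -> (K -> R) -> (K -> R)) (alpha : G -> K -> K) :
  is_topgroup mul inv one ->
  amenable R mul one ->
  compact [set: K] -> hausdorff_space K ->
  isometric_action mul one T ->
  induced_action T alpha ->
  ((exists (n : nat) (M : 'I_n -> set K),
      (forall i, minimal_subspace alpha (M i)) /\
      (forall i j, i <> j -> M i `&` M j = set0) /\
      \bigcup_(i in [set: 'I_n]) M i = [set: K])
   \/
   (metrizable R K /\
    exists (I : Type) (M : I -> set K),
      (forall i, minimal_subspace alpha (M i)) /\
      (forall i j, i <> j -> M i `&` M j = set0) /\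
      \bigcup_(i in [set: I]) M i = [set: K])) ->
  exists N : (K -> R) -> R, good_norm T N.
Proof.
(* Amenability concerns pointed spaces, so empty [K] is separate: all functions coincide there and
   the zero norm works. *)
have [[p _]|K0] := pselect ([set: K] !=set0); last first.
  move=> _ _ _ _ _ _ _; exists (fun _ => 0).
  have eqK (f h : K -> R) : f = h.
    by apply/funext => x; exfalso; apply: K0; exists x.
  have sup0 (f : K -> R) : supnorm f = 0.
    by apply/le_anti; rewrite supnorm_ge0 supnorm_le// => x; exfalso; apply: K0; exists x.
  split; first by split => [f _ _|c f _]; [exact: eqK|rewrite mulr0].
  - by split => [f h _ _|//]; rewrite addr0.
  - by exists 1 => //; exists 1 => // f _; rewrite sup0 mulr0.
  - by [].
  - by move=> f h _ _ []; exact: eqK.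
(* Unpacking [K] allows [p] to be attached as its distinguished point with the topology
   unchanged. *)
case: K T alpha p => K clK T alpha p topG amG cK hK isoT indT minK.
pose P : ptopologicalType := pointed_at (Topological.Pack clK) p.
suff [M denseM] : exists M, dense_sequence_of_minimal_subspaces G P alpha M.
  exact: (dense_minimal_good_norm R G mul inv one P T alpha M).
case: minK => [[n [M [minM [_ covM]]]]|[metK [I [M [minM [_ covM]]]]]].
- exact: (finite_union_dense_sequence G P alpha n M).
- exact: (metrizable_union_dense_sequence R G P alpha I M).
Qed.
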